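(* Let $n\ge1$ and let $p_1,\dots,p_n\in(0,1]$ be such that $R_1\le 1$. Then $$\mathcal{V}^*(p_1,\dots,p_n)\;>\;\frac{R_1}{e^{R_1}-1}\;\ge\;\frac{1}{e-1}.$$
   Context: Last-success game: independent Bernoulli variables $I_1,\dots,I_n$ with $P(I_i=1)=p_i>0$ are observed sequentially, and the player wins if he stops on the last variable equal to $1$. Put $r_i=p_i/(1-p_i)$ (with $r_i=\infty$ if $p_i=1$), $R_k=\sum_{i=k}^n r_i\in[0,\infty]$ (empty sum $=0$). The optimal threshold is $\mathbf{s}=\max\{1\le k\le n: R_k\ge 1\}$ if $R_1\ge 1$, and $\mathbf{s}=1$ otherwise. In Variant I, if all the variables turn out to be $0$ this is not a failure: the game is repeated as many times as necessary until a $1$ appears. $\mathcal{V}^*(p_1,\dots,p_n)$ denotes the probability of winning Variant I using the optimal strategy; when $p_i<1$ for all $i$ (which is the case if $R_1\le1$), it is given by $$\mathcal{V}^*(p_1,\dots,p_n)=\frac{\Big(\sum_{i=\mathbf{s}}^n\frac{p_i}{1-p_i}\Big)\prod_{i=\mathbf{s}}^n(1-p_i)}{1-\prod_{i=1}^n(1-p_i)}.$$ *)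

(* Defs.v *)
From mathcomp Require Import all_boot all_order all_algebra.
From mathcomp Require Import all_classical all_reals all_analysis.
Import Order.TTheory GRing.Theory Num.Theory numFieldNormedType.Exports.

Set Implicit Arguments.
Unset Strict Implicit.
Unset Printing Implicit Defensive.

Local Open Scope classical_set_scope.
Local Open Scope ring_scope.

Definition odds {R : realType} (x : R) : \bar R :=
  if x == 1 then +oo%E else (x / (1 - x))%:E.

Definition odds_sum {R : realType} {n : nat} (p : 'I_n -> R) : \bar R :=
  (\sum_(i < n) odds (p i))%E.

(* The values of the n variables in one round; true encodes 1. *)
Definition outcome (n : nat) := {ffun 'I_n -> bool}.

Definition all_zero {n : nat} (x : outcome n) : bool := [forall i, ~~ x i].

Definition observed {n : nat} (x : outcome n) (k : 'I_n) : seq bool :=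
  [seq x i | i : 'I_n <- enum 'I_n & (i <= k)%N].

(* A stopping rule for one round says, from the values observed so far in the
   round, whether to stop; play stops at the first index at which it says so. *)
Definition rule := seq bool -> bool.

Definition stops_at {n : nat} (t : rule) (x : outcome n) (k : 'I_n) : bool :=
  t (observed x k) && [forall i : 'I_n, (i < k)%N ==> ~~ t (observed x i)].

Definition wins_round {n : nat} (t : rule) (x : outcome n) : bool :=
  [exists k : 'I_n,
     [&& stops_at t x k, x k & [forall i : 'I_n, (k < i)%N ==> ~~ x i]]].

(* A strategy for the repeated game gives the rule for each round.  A round is
   played only if all earlier ones were identically 0, so its number carries
   the whole information provided by the earlier rounds. *)
Definition strategy := nat -> rule.

Definition wins_within {n N : nat} (s : strategy)
    (w : {ffun 'I_N -> outcome n}) : bool :=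
  [exists j : 'I_N,
     [forall i : 'I_N, (i < j)%N ==> all_zero (w i)] && wins_round (s j) (w j)].

(* Probability of an event about N rounds, all n * N variables being
   independent and the i-th variable of each round being Bernoulli (p i). *)
Definition prob_rounds {R : realType} {n N : nat} (p : 'I_n -> R)
    (E : pred {ffun 'I_N -> outcome n}) : R :=
  \sum_(w : {ffun 'I_N -> outcome n} | E w)
    \prod_(j < N) \prod_(i < n) (if w j i then p i else 1 - p i).

(* The events "win within N rounds" increase with N to the event "win". *)
Definition win_prob {R : realType} {n : nat} (p : 'I_n -> R) (s : strategy) : R :=
  limn (fun N : nat => prob_rounds p (@wins_within n N s)).

Definition optimal_win_prob {R : realType} {n : nat} (p : 'I_n -> R) : R :=
  sup [set win_prob p s | s in [set: strategy]].

(* Main.v *)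
(* Stopping at the first 1 of every round wins exactly when the first round
   that is not identically 0 contains a single 1.  With Q = prod (1 - p_i), one
   round has exactly one 1 with probability Q R_1, so this strategy wins with
   probability Q R_1 / (1 - Q) = R_1 / (prod (1 + r_i) - 1), and
   prod (1 + r_i) < exp R_1.  The second inequality is the convexity of exp
   on [0, 1]. *)
Require Import Defs.
From mathcomp Require Import all_boot all_order all_algebra.
From mathcomp Require Import all_classical all_reals all_analysis.
From mathcomp Require Import ring lra.
Import Order.TTheory GRing.Theory Num.Theory numFieldNormedType.Exports.
Local Open Scope ring_scope.

(** After exchanging the two sums, disjointness lets each [x] contribute to at most one index. This
    serves to split by the winning round, then by the position of the single 1. *)
Lemma sum_exists_disjoint {V : nmodType} {I T : finType} (E : I -> pred T)
    (F : T -> V) :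
  (forall i j x, E i x -> E j x -> i = j) ->
  \sum_(x | [exists i, E i x]) F x = \sum_i \sum_(x | E i x) F x.
Proof.
move=> disjE; under [RHS]eq_bigr do rewrite big_mkcond.
rewrite exchange_big big_mkcond; apply: eq_bigr => x _.
case: existsP => [[i Eix]|noE].
  rewrite (bigD1 i) //= Eix big1 ?addr0// => j jNi.
  by case: ifP => // Ejx; rewrite (disjE _ _ _ Ejx Eix) eqxx in jNi.
by rewrite big1// => i _; case: ifP => // Eix; case: noE; exists i.
Qed.

Definition round_mass {R : realType} {n : nat} (p : 'I_n -> R)
    (x : outcome n) : R :=
  \prod_(i < n) (if x i then p i else 1 - p i).

Definition round_win_prob {R : realType} {n : nat} (p : 'I_n -> R)
    (t : rule) : R :=
  \sum_(x : outcome n | wins_round t x) round_mass p x.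

Definition zero_prob {R : realType} {n : nat} (p : 'I_n -> R) : R :=
  \prod_(i < n) (1 - p i).

Section Rounds.
Context {R : realType} {n : nat} (p : 'I_n -> R).

Lemma sum_round_mass : \sum_(x : outcome n) round_mass p x = 1.
Proof.
rewrite /round_mass.
rewrite -(bigA_distr_bigA (fun (i : 'I_n) b => if b then p i else 1 - p i)).
by rewrite big1// => i _; rewrite big_bool /= addrC subrK.
Qed.

Lemma sum_all_zero : \sum_(x : outcome n | all_zero x) round_mass p x = zero_prob p.
Proof.
rewrite (big_pred1 [ffun=> false]) => [|x].
  by apply: eq_bigr => i _; rewrite ffunE.
apply/forallP/eqP => [x0|->] /=; last by move=> i; rewrite ffunE.
by apply/ffunP => i; rewrite ffunE; apply/negbTE.
Qed.

Lemma wins_round_not_all_zero (t : rule) (x : outcome n) :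
  wins_round t x -> ~~ all_zero x.
Proof.
case/existsP => k /and3P[_ xk _]; apply/forallPn; exists k.
by rewrite negbK.
Qed.

(** The winning round [j] is unique: a won round contains a 1, while all rounds before the winning
    one are zero. For fixed [j] the event imposes a separate condition on each round, so its mass
    factors. *)
Lemma prob_wins_within (N : nat) (s : strategy) :
  prob_rounds p (@wins_within n N s) =
  \sum_(j < N) zero_prob p ^+ j * round_win_prob p (s j).
Proof.
rewrite /prob_rounds /wins_within sum_exists_disjoint; last first.
  move=> i j w /andP[/forallP zi /wins_round_not_all_zero wi].
  move=> /andP[/forallP zj /wins_round_not_all_zero wj].
  case: (ltngtP i j) => [ij|ji|/val_inj//].
    by have := zj i; rewrite ij (negbTE wi).
  by have := zi j; rewrite ji (negbTE wj).
apply: eq_bigr => j _.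
(* [A i] is the condition that a win in round [j] puts on round [i]; rounds after [j] are free. *)
pose A (i : 'I_N) : pred (outcome n) :=
  if (i < j)%N then all_zero else if i == j then wins_round (s j) else predT.
rewrite (eq_bigl (fun w => w \in family A)); last first.
  move=> w; apply/andP/familyP => /= [[/forallP zw ww] i|wA].
    rewrite /A; case: ifP => [ij|_]; first by have := zw i; rewrite ij.
    by case: eqP => [->|].
  split; last by have := wA j; rewrite /A ltnn eqxx.
  by apply/forallP => i; apply/implyP => ij; have := wA i; rewrite /A ij.
rewrite -(bigA_distr_big_dep A (fun=> round_mass p)) (bigD1 j)//=.
rewrite {1}/A ltnn eqxx mulrC; congr (_ * _).
rewrite -[in RHS](card_ord j) -prodr_const.
(* With the power spread over all [N] rounds, factors are compared one by one; each round after [j]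
   contributes its total mass 1. *)
rewrite (big_ord_widen N (fun=> zero_prob p)) 1?ltnW// big_mkcond [RHS]big_mkcond.
apply: eq_bigr => i _; rewrite /A -val_eqE /=.
by case: (ltngtP i j) => //= _; rewrite ?sum_all_zero ?sum_round_mass.
Qed.

(** [observed x k] includes the value at [k] itself, so [has id] stops exactly on the first 1. That
    1 is also the last one only if it is alone. *)
Lemma wins_first_one (x : outcome n) :
  wins_round (has id) x = [exists k : 'I_n, x == [ffun i => i == k]].
Proof.
have obsP (k : 'I_n) : reflect (exists2 i : 'I_n, (i <= k)%N & x i)
    (has id (observed x k)).
  rewrite /observed has_map; apply: (iffP hasP) => [[i]|[i ik xi]].
    by rewrite mem_filter => /andP[ik _] xi; exists i.
  by exists i; rewrite // mem_filter ik mem_enum.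
apply/existsP/existsP => -[k].
  move=> /and3P[/andP[_ /forallP before] xk /forallP after].
  exists k; apply/eqP/ffunP => i; rewrite ffunE.
  case: (ltngtP i k) => [ik|ki|/val_inj->]; last by rewrite eqxx xk.
    rewrite -val_eqE ltn_eqF//; apply/negbTE; have := before i; rewrite ik /=.
    by apply: contra => xi; apply/obsP; exists i.
  by rewrite -val_eqE gtn_eqF//; apply/negbTE; have := after i; rewrite ki.
move=> /eqP xE; exists k; apply/and3P; split.
- apply/andP; split; first by apply/obsP; exists k; rewrite // xE ffunE eqxx.
  apply/forallP => i; apply/implyP => ik; apply/negP => /obsP[j ji].
  rewrite xE ffunE => /eqP jk; move: ji; rewrite jk.
  by rewrite leqNgt ik.
- by rewrite xE ffunE eqxx.
- apply/forallP => i; apply/implyP => ki; rewrite xE ffunE.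
  by rewrite -val_eqE gtn_eqF.
Qed.

Lemma round_win_prob_first_one :
  round_win_prob p (has id) = \sum_k p k * \prod_(i | i != k) (1 - p i).
Proof.
rewrite /round_win_prob (eq_bigl _ _ wins_first_one) sum_exists_disjoint.
  apply: eq_bigr => k _; rewrite big_pred1_eq /round_mass (bigD1 k)//= ffunE eqxx.
  by congr (_ * _); apply: eq_bigr => i /negbTE ik; rewrite ffunE ik.
move=> k l x /eqP-> /eqP /ffunP /(_ k); rewrite !ffunE eqxx.
by move=> /esym/eqP.
Qed.

Hypothesis hp : forall i, 0 <= p i <= 1.

Lemma round_mass_ge0 (x : outcome n) : 0 <= round_mass p x.
Proof.
by apply: prodr_ge0 => i _; have /andP[p0 p1] := hp i; case: ifP; rewrite ?subr_ge0.
Qed.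

Lemma zero_prob_ge0 : 0 <= zero_prob p.
Proof. by apply: prodr_ge0 => i _; rewrite subr_ge0; case/andP: (hp i). Qed.

Lemma prob_rounds_le1 (N : nat) (E : pred {ffun 'I_N -> outcome n}) :
  prob_rounds p E <= 1.
Proof.
have -> : 1 = \sum_(w : {ffun 'I_N -> outcome n}) \prod_j round_mass p (w j).
  rewrite -(bigA_distr_bigA (fun=> round_mass p)) big1// => j _.
  exact: sum_round_mass.
rewrite /prob_rounds big_mkcond; apply: ler_sum => w _.
by case: ifP => // _; apply: prodr_ge0 => j _; apply: round_mass_ge0.
Qed.

(** The bound passes to the limit once the limit exists: each further round adds a nonnegative term,
    so the sequence is nondecreasing and bounded. *)
Lemma win_prob_le1 (s : strategy) : win_prob p s <= 1.
Proof.
apply: limr_le; last by apply: nearW => N; apply: prob_rounds_le1.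
apply: nondecreasing_is_cvgn; last first.
  by exists 1 => _ [N _ <-]; apply: prob_rounds_le1.
apply/nondecreasing_seqP => N; rewrite !prob_wins_within big_ord_recr lerDl.
rewrite mulr_ge0 ?exprn_ge0 ?zero_prob_ge0//.
by apply: sumr_ge0 => x _; apply: round_mass_ge0.
Qed.

(** The uniform bound 1 makes [sup] a genuine supremum rather than a default value. *)
Lemma win_prob_le_optimal (s : strategy) : win_prob p s <= optimal_win_prob p.
Proof.
apply: ub_le_sup; last by exists s.
by exists 1 => _ [t _ <-]; apply: win_prob_le1.
Qed.

(** Using the same rule in every round makes the winning probability a geometric series of ratio
    [zero_prob p]. *)
Lemma win_prob_stationary (t : rule) : zero_prob p < 1 ->
  win_prob p (fun=> t) = round_win_prob p t / (1 - zero_prob p).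
Proof.
move=> Q1; apply: cvg_lim => //.
have -> : (fun N => prob_rounds p (@wins_within n N (fun=> t))) =
    series (geometric (round_win_prob p t) (zero_prob p)).
  apply/funext => N; rewrite prob_wins_within seriesEord.
  by apply: eq_bigr => j _; rewrite mulrC.
by apply: cvg_geometric_series; rewrite ger0_norm ?zero_prob_ge0.
Qed.

End Rounds.

(** Multiply the strict bounds 1 + x < exp x; having at least one factor keeps the product
    strict. *)
Lemma prod_lt_expR_sum {R : realType} {n : nat} (r : 'I_n -> R) :
  (0 < n)%N -> (forall i, 0 < r i) ->
  \prod_i (1 + r i) < expR (\sum_i r i).
Proof.
case: n r => // n r _ r0; rewrite expR_sum; apply: ltr_prod.
  by apply/hasP; exists ord0; rewrite ?mem_index_enum.
by move=> i _; rewrite addr_ge0 ?ltW//= expR_gt1Dx ?gt_eqF.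
Qed.

Lemma expR_le_chord {R : realType} (x : R) : 0 <= x <= 1 ->
  expR x - 1 <= x * (expR 1 - 1).
Proof.
move=> x01.
(* The point [x] is the convex combination of 1 and 0 with weights [x] and [1 - x]. *)
have := convex_expR (@Itv01 R x (proj1 (andP x01)) (proj2 (andP x01))) 1 0.
rewrite !convRE /= expR0 /unstable.onem !mulr1 mulr0 addr0; lra.
Qed.

(** A single [p i = 1] would make the sum infinite, since no term is -oo. Hence all odds are finite
    and the computation can move to the reals. *)
Lemma odds_sum_le1 {R : realType} {n : nat} (p : 'I_n -> R) :
  (forall i, 0 < p i <= 1) -> (odds_sum p <= 1%:E)%E ->
  (forall i, p i < 1) /\ odds_sum p = (\sum_i p i / (1 - p i))%:E.
Proof.
move=> hp hR.
have p1 i : p i < 1.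
  have /andP[pi0 pi1] := hp i; rewrite lt_neqAle pi1 andbT.
  apply/eqP => pi1E; move: hR; rewrite leNgt => /negP; apply.
  suff -> : odds_sum p = +oo%E by rewrite ltry.
  rewrite /odds_sum; apply/esum_eqyP => [j _|].
    by rewrite /odds; case: ifP.
  by exists i; rewrite mem_index_enum /odds pi1E eqxx.
split=> //; rewrite /odds_sum -sumEFin; apply: eq_bigr => i _.
by rewrite /odds lt_eqF.
Qed.

Theorem theorem8 (R : realType) (n : nat) (p : 'I_n -> R)
    (hn : (1 <= n)%N)
    (hp : forall i : 'I_n, 0 < p i <= 1)
    (hR : (odds_sum p <= 1%:E)%E) :
  let R1 : R := fine (odds_sum p) in
  R1 / (expR R1 - 1) < optimal_win_prob p /\
  1 / (expR 1 - 1) <= R1 / (expR R1 - 1).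
Proof.
have [p1 R1E] := odds_sum_le1 p hp hR.
move: hR; rewrite {}R1E /= lee_fin; set S := \sum_i _ => S1.
have p0 i : 0 < p i by case/andP: (hp i).
have q0 i : 0 < 1 - p i by rewrite subr_gt0.
have r0 i : 0 < p i / (1 - p i) by rewrite divr_gt0.
have S0 : 0 < S.
  rewrite /S (bigD1 (Ordinal hn))//= ltr_pwDl//.
  by apply: sumr_ge0 => i _; apply: ltW.
have e1 (x : R) : 0 < x -> 0 < expR x - 1 by move=> x0; rewrite subr_gt0 expR_gt1.
(* The second inequality, with denominators cleared, is the chord bound at [S]. *)
split; last first.
  rewrite ler_pdivrMr ?e1// mulrAC ler_pdivlMr ?e1// mul1r.
  by apply: expR_le_chord; rewrite ltW.
have Q0 : 0 < zero_prob p by apply: prodr_gt0.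
(* Factor by factor, 1 / (1 - p) = 1 + p / (1 - p). *)
have QV : (zero_prob p)^-1 = \prod_i (1 + p i / (1 - p i)).
  rewrite -prodfV; apply: eq_bigr => i _.
  by have := q0 i => /lt0r_neq0 ?; field.
have Q1 : zero_prob p < 1.
  apply: (@lt_le_trans _ _ (\prod_(i < n) 1)); last by rewrite big1_eq.
  apply: ltr_prod => [|i _]; last by rewrite ltW//= gtrBl.
  by apply/hasP; exists (Ordinal hn); rewrite ?mem_index_enum.
have QS : round_win_prob p (has id) = zero_prob p * S.
  rewrite round_win_prob_first_one mulr_sumr; apply: eq_bigr => k _.
  rewrite /zero_prob [in RHS](bigD1 k)//=.
  by have := q0 k => /lt0r_neq0 ?; field.
have hp' i : 0 <= p i <= 1 by rewrite !ltW.
(* It suffices that stopping at the first 1 in every round already beats the bound strictly. *)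
apply: lt_le_trans (win_prob_le_optimal p hp' (fun=> has id)).
rewrite win_prob_stationary// QS.
have -> : zero_prob p * S / (1 - zero_prob p) = S / ((zero_prob p)^-1 - 1).
  have QN0 := lt0r_neq0 Q0; have DN0 : 1 - zero_prob p != 0.
    by rewrite subr_eq0 eq_sym lt_eqF.
  by field; rewrite QN0 mulN1r.
have DV0 : 0 < (zero_prob p)^-1 - 1 by rewrite subr_gt0 invf_gt1.
(* Both fractions have the positive numerator [S], so only the denominators are compared. *)
rewrite ltr_pM2l// ltf_pV2 ?posrE ?e1// ltrD2r QV.
exact: prod_lt_expR_sum.
Qed.
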